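(* Let $(\mathcal E,\mathcal F)$ be a regular resistance form on a non-empty set $F$ with resistance metric $R$ such that $(F,R)$ is separable and locally compact, and let $\mu$ be a Radon measure on $(F,R)$ of full support. Let $\mathcal D_e$ be the extended Dirichlet space of the Dirichlet form $(\mathcal E,\mathcal D)$ associated with $(F,R,\mu)$, regarded as a subspace of $C(F,\mathbb R)$ (every element of $\mathcal D_e$ being identified with its continuous modification). Then $$\mathcal D_e=\mathcal F^{(1)} .$$
   Context: **Resistance forms.** A pair $(\mathcal E,\mathcal F)$ is a resistance form on a non-empty set $F$ if: (RF1) $\mathcal F$ is a linear space of functions $F\to\mathbb R$ containing constants, $\mathcal E$ is a non-negative symmetric bilinear form on $\mathcal F$, and $\mathcal E(f,f)=0$ iff $f$ is constant; (RF2) $\mathcal F$ modulo constants is a Hilbert space under $\mathcal E$; (RF3) $\mathcal F$ separates points; (RF4) $R(x,y):=\sup\{|f(x)-f(y)|^2/\mathcal E(f,f):f\in\mathcal F,\mathcal E(f,f)>0\}<\infty$ for all $x,y$; (RF5) $\bar f=(f\wedge1)\vee0\in\mathcal F$ and $\mathcal E(\bar f,\bar f)\le\mathcal E(f,f)$ for $f\in\mathcal F$. Then $R$ is a metric (the resistance metric); $F$ carries the topology of $R$, and $\mathcal F\subseteq C(F,\mathbb R)$. The form is regular if $\mathcal F\cap C_c(F,\mathbb R)$ is dense in $C_c(F,\mathbb R)$ (compactly supported continuous functions) in the supremum norm. **The space $\mathcal F^{(1)}$.** Fix $x_0\in F$ and set $\mathcal E^{(1)}(u,v)=\mathcal E(u,v)+u(x_0)v(x_0)$,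 an inner product on $\mathcal F$ making it a Hilbert space. $\mathcal F^{(1)}$ is the closure of $C_c(F,\mathbb R)\cap\mathcal F$ in $(\mathcal F,\mathcal E^{(1)})$; it does not depend on $x_0$. **Dirichlet form.** $\mathcal E_1(f,g)=\mathcal E(f,g)+\int_Ffg\,d\mu$ on $\mathcal F\cap L^2(F,\mu)$; $\mathcal D$ is the closure of $\mathcal F\cap C_c(F,\mathbb R)$ in $(\mathcal F\cap L^2(F,\mu),\mathcal E_1)$. The extended Dirichlet space $\mathcal D_e$ consists of the ($\mu$-equivalence classes of) measurable extended real-valued functions $f$ with $|f|<\infty$ $\mu$-a.e. for which there is an $\mathcal E$-Cauchy sequence $(f_n)$ in $\mathcal D$ with $f_n\to f$ $\mu$-a.e. It is known that every $f\in\mathcal D_e$ has a continuous modification. *)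

(* Defs.v *)
From HB Require Import structures.
From mathcomp Require Import all_boot all_order all_algebra.
From mathcomp Require Import all_classical all_reals all_analysis.
From mathcomp Require Import measurable_realfun.
From mathcomp Require Import ring.
Import Order.TTheory GRing.Theory Num.Theory.
Import numFieldNormedType.Exports.

Set Implicit Arguments.
Unset Strict Implicit.
Unset Printing Implicit Defensive.

Local Open Scope classical_set_scope.
Local Open Scope ring_scope.

(* The library's measurable types are pointed, so the Borel sigma-algebra of a
   metric space is only available when the space is pointed, i.e. non-empty. *)
#[short(type="pmetricType")]
HB.structure Definition PointedMetric (K : numDomainType) :=
  { M of Pointed M & Metric K M }.

Notation borel T := (g_sigma_algebraType (@open T)).

Section forms.
Context {R : realType} {T : Type}.
(* A form on a space [F] of functions is a total function [E] whose values
   matter only on [F]. *)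
Implicit Types (F C : set (T -> R)) (E : (T -> R) -> (T -> R) -> R).

Definition form_cauchy E (u : nat -> T -> R) :=
  forall e, 0 < e -> exists N, forall m n, (N <= m)%N -> (N <= n)%N ->
    E (u m \- u n) (u m \- u n) < e.

Definition form_cvg E (u : nat -> T -> R) (f : T -> R) :=
  E (u n \- f) (u n \- f) @[n --> \oo] --> 0.

Definition form_closure F E C : set (T -> R) :=
  [set f | F f /\ forall e, 0 < e ->
    exists2 g, C g & E (f \- g) (f \- g) < e].

(* The supremum is over the empty set, hence equal to -oo, when every function
   in [F] is constant. *)
Definition resistance F E (x y : T) : \bar R :=
  ereal_sup [set ((`|f x - f y| ^+ 2) / E f f)%:E | f in
    [set f | F f /\ 0 < E f f]].

(* Since [fine -oo = 0], the distance is 0 when every function in [F] is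
   constant; by [rf_separates] this happens only on a one-point space. *)
Definition resistance_dist F E (x y : T) : R := fine (resistance F E x y).

Record resistance_form F E : Prop := {
  rf_cst : forall c : R, F (cst c) ;
  rf_lin : forall (a : R) f g, F f -> F g -> F (fun x => a * f x + g x) ;
  rf_sym : forall f g, F f -> F g -> E f g = E g f ;
  rf_bilin : forall (a : R) f g h, F f -> F g -> F h ->
    E (fun x => a * f x + g x) h = a * E f h + E g h ;
  rf_ge0 : forall f, F f -> 0 <= E f f ;
  rf_eq0 : forall f, F f -> (E f f = 0 <-> exists c : R, f = cst c) ;
  (* by [rf_ge0] and [rf_eq0], [E] is an inner product modulo constants; being
     Hilbert amounts to completeness *)
  rf_complete : forall u : nat -> T -> R, (forall n, F (u n)) ->
    form_cauchy E u -> exists2 f, F f & form_cvg E u f ;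
  rf_separates : forall x y : T, x <> y -> exists2 f, F f & f x <> f y ;
  rf_resistance : forall x y : T, (resistance F E x y < +oo)%E ;
  rf_markov : forall f, F f ->
    let fbar := fun x => Num.max (Num.min (f x) 1) 0 in
    F fbar /\ E fbar fbar <= E f f
}.

End forms.

Definition separable (T : topologicalType) :=
  exists2 S : set T, countable S & dense S.

Section spaces.
Context {R : realType} {T : pmetricType R}.
Variables (F : set (T -> R)) (E : (T -> R) -> (T -> R) -> R).
Variable mu : {measure set (borel T) -> \bar R}.

Definition Cc : set (T -> R) :=
  [set f | continuous f /\ compact (closure [set x | f x != 0])].

Definition regular_form := forall f, Cc f -> forall e : R, 0 < e ->
  exists2 g, (F `&` Cc) g & forall x, `|f x - g x| <= e.

Record radon_measure : Prop := {
  radon_compact : forall K : set T, compact K -> (mu K < +oo)%E ;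
  radon_outer : forall A : set (borel T), measurable A ->
    mu A = ereal_inf [set mu U | U in [set U : set T | open U /\ A `<=` U]] ;
  radon_inner : forall U : set T, open U ->
    mu U = ereal_sup [set mu K | K in [set K : set T | compact K /\ K `<=` U]]
}.

Definition full_support :=
  forall U : set T, open U -> U !=set0 -> (0 < mu U)%E.

Definition E_at (x0 : T) (u v : T -> R) : R := E u v + u x0 * v x0.

Definition F1 (x0 : T) : set (T -> R) :=
  form_closure F (E_at x0) (F `&` Cc).

Definition E1 (f g : T -> R) : R := E f g + \int[mu]_x (f x * g x).

Definition L2 : set (borel T -> R) := [set f | f \in Lfun mu 2%:E].

Definition dirichlet_domain : set (T -> R) :=
  form_closure (F `&` L2) E1 (F `&` Cc).

Definition extended_dirichlet : set (borel T -> \bar R) :=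
  [set f | [/\ measurable_fun setT f,
    {ae mu, forall x, f x \is a fin_num} &
    exists u : nat -> T -> R, [/\ forall n, dirichlet_domain (u n),
      form_cauchy E u &
      {ae mu, forall x, (u n x)%:E @[n --> \oo] --> f x}]]].

Definition continuous_modification (f : borel T -> \bar R) (g : T -> R) :=
  continuous g /\ {ae mu, forall x, f x = (g x)%:E}.

(* The extended Dirichlet space inside C(T, R): every element has exactly one
   continuous modification, by [extended_dirichlet_modification] below. *)
Definition extended_dirichlet_cont : set (T -> R) :=
  [set g | exists2 f, extended_dirichlet f & continuous_modification f g].

End spaces.

Section modification.
Context {R : realType} {T : pmetricType R}.
Variables (F : set (T -> R)) (E : (T -> R) -> (T -> R) -> R).
Variable mu : {measure set (borel T) -> \bar R}.
Hypotheses (hE : resistance_form F E)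
  (hR : forall x y : T, mdist x y = resistance_dist F E x y)
  (hsupp : full_support mu).

Lemma resistance_ineq f x y : F f ->
  `|f x - f y| ^+ 2 <= mdist x y * E f f.
Proof.
move=> Ff; have := rf_ge0 hE Ff; rewrite le_eqVlt => /orP[/eqP/esym E0|E0].
  have /(rf_eq0 hE Ff)[c ->] := E0.
  by rewrite subrr normr0 expr0n/= mulr_ge0// ?mdist_ge0//; apply: (rf_ge0 hE (rf_cst hE _)).
rewrite -ler_pdivrMr// hR -lee_fin /resistance_dist.
have h : ((`|f x - f y| ^+ 2 / E f f)%:E <= resistance F E x y)%E.
  by apply: ereal_sup_ubound; exists f.
rewrite fineK// fin_real// (rf_resistance hE) andbT.
by apply: lt_le_trans h; exact: ltNyr.
Qed.

Lemma rf_continuous f : F f -> continuous f.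
Proof.
move=> Ff x; apply/cvgrPdist_lt => e e0.
have E1 : 0 < E f f + 1 by rewrite ltr_wpDl// (rf_ge0 hE Ff).
apply/nbhs_ballP; exists (e ^+ 2 / (E f f + 1)) => /=.
  by rewrite divr_gt0// exprn_gt0.
move=> y; rewrite ballEmdist/= ltr_pdivlMr// => xy.
rewrite -(@ltr_pXn2r _ 2)// ?nnegrE ?normr_ge0 ?(ltW e0)//.
apply: le_lt_trans (resistance_ineq x y Ff) _.
by apply: le_lt_trans xy; rewrite ler_wpM2l ?mdist_ge0// lerDl.
Qed.

Lemma rf_sub f g : F f -> F g -> F (f \- g).
Proof.
move=> Ff Fg; have := rf_lin hE (-1) Fg Ff.
by congr F; apply/funext => z; rewrite mulN1r addrC.
Qed.

Lemma full_support_ae (P : T -> Prop) :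
  {ae mu, forall x, P x} -> dense [set x | P x].
Proof.
move=> [A [mA A0 PA]] U U0 oU.
apply/set0P/negP => /eqP UP0.
have UA : U `<=` A.
  move=> z Uz; apply: PA => /= Pz.
  by have : set0 z by rewrite -UP0.
have mU : measurable (U : set (borel T)) by apply: sub_sigma_algebra.
have := hsupp oU U0; rewrite ltNge => /negP; apply.
by rewrite -A0; apply: le_measure => //; rewrite inE.
Qed.

Lemma extended_dirichlet_modification f : extended_dirichlet F E mu f ->
  exists! g, continuous_modification mu f g.
Proof.
move=> [_ ffin [u [Du uC uf]]].
have Fu n : F (u n) by have [[]] := Du n.
have [h Fh uh] := rf_complete hE Fu uC.
have [x1 [_ [f1 u1]]] : setT `&` [set x | f x \is a fin_num /\
    (u n x)%:E @[n --> \oo] --> f x] !=set0.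
  apply: full_support_ae; first by apply: filterS2 ffin uf => z; split.
  - by exists point.
  - exact: openT.
set c := fine (f x1).
have {}u1 : u n x1 @[n --> \oo] --> c.
  have : (u n x1)%:E @[n --> \oo] --> c%:E by rewrite /c fineK.
  exact: fine_cvg.
have sq0 x : (u n \- h) x - (u n \- h) x1 @[n --> \oo] --> 0.
  have b0 : mdist x x1 * E (u n \- h) (u n \- h) @[n --> \oo] --> 0.
    by rewrite -[X in _ --> X](mulr0 (mdist x x1)); apply: cvgMr.
  apply/cvgrPdist_lt => e e0.
  have e20 : 0 < e ^+ 2 by rewrite exprn_gt0.
  move/cvgrPdist_lt : b0 => /(_ _ e20); apply: filterS => n.
  rewrite !sub0r !normrN => bn.
  rewrite -(@ltr_pXn2r _ 2)// ?nnegrE ?normr_ge0 ?(ltW e0)//.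
  apply: le_lt_trans (le_lt_trans (ler_norm _) bn).
  exact: resistance_ineq (rf_sub (Fu n) Fh).
pose g : T -> R := fun x => h x - h x1 + c.
have ug x : u n x @[n --> \oo] --> g x.
  have -> : (fun n => u n x) =
      (fun n => ((u n \- h) x - (u n \- h) x1) + (h x - h x1) + u n x1).
    by apply/funext => n /=; rewrite !opprB !addrA; ring.
  have -> : g x = 0 + (h x - h x1) + c by rewrite add0r.
  exact: (cvgD (cvgD (sq0 x) (cvg_cst (h x - h x1))) u1).
have gc : continuous g.
  move=> x.
  exact: (cvgD (cvgB (@rf_continuous _ Fh x) (cvg_cst _)) (cvg_cst _)).
have fg : {ae mu, forall x, f x = (g x)%:E}.
  apply: filterS2 ffin uf => x _ ux.
  apply: (cvg_unique _ ux) => //.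
  by apply: cvg_EFin; [exact: nearW|exact: ug].
exists g; split; first by split.
move=> g' [g'c fg']; apply/funext => x.
apply/eqP; apply/negPn/negP => gg'.
pose U := [set z | (g z - g' z) != 0].
have oU : open U.
  apply: (@open_comp _ _ (g \- g') [set y | y != 0]); last exact: open_neq.
  by move=> z _; exact: (cvgB (gc z) (g'c z)).
have : U `&` [set z | f z = (g z)%:E /\ f z = (g' z)%:E] !=set0.
  apply: full_support_ae => //; first by apply: filterS2 fg fg' => z; split.
  by exists x; rewrite /U/= subr_eq0.
move=> [z [+ [e1 e2]]]; rewrite /U/= subr_eq0.
by move: e2; rewrite e1 => -[->]; rewrite eqxx.
Qed.

End modification.

(* Main.v *)
(** Both inclusions rest on the oscillation bound
    |f x - f y|^2 <= R(x, y) E(f, f).  It upgrades energy convergence plus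
    convergence at one point to pointwise convergence everywhere; this turns an
    approximating sequence for F^(1) into one for D_e, and identifies the limit
    in D_e, up to its constant, from a single point of convergence.  Conversely,
    a function of D is approximated by F `&` Cc in the E_1-norm, which controls
    the value at x0: on a small open set U around x0, 0 < mu U < +oo, a large
    value at x0 with small energy would force a large L2-norm. *)
Require Import Defs.
From mathcomp Require Import all_boot all_order all_algebra.
From mathcomp Require Import all_classical all_reals all_analysis.
From mathcomp Require Import measurable_realfun.
From mathcomp Require Import ring lra.
Import Order.TTheory GRing.Theory Num.Theory.
Import numFieldNormedType.Exports.

Set Implicit Arguments.
Unset Strict Implicit.

Local Open Scope classical_set_scope.
Local Open Scope ring_scope.

(** A triangle inequality free of square roots. It is to point values what [rf_subE_le] is to
    energies, so the two add up in [E_at_subE_le]. *)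
Lemma sqrrB_le {R : realType} (a b c : R) :
  (a - c) ^+ 2 <= 2 * (a - b) ^+ 2 + 2 * (b - c) ^+ 2.
Proof. by have := sqr_ge0 ((a - b) - (b - c)); rewrite !expr2; nra. Qed.

Lemma sqr_cvg0 {R : realType} (u : nat -> R) :
  u n ^+ 2 @[n --> \oo] --> 0 -> u n @[n --> \oo] --> 0.
Proof.
move=> u20; apply/norm_cvg0P; rewrite -(sqrtr0 R).
under eq_fun do rewrite -sqrtr_sqr.
by apply: continuous_cvg u20; exact: sqrt_continuous.
Qed.

(** * Energy estimates and energy convergence *)

Section resistance_forms.
Context {R : realType} {T : pmetricType R}.
Variables (F : set (T -> R)) (E : (T -> R) -> (T -> R) -> R).
Hypotheses (hE : resistance_form F E)
  (hR : forall x y : T, mdist x y = resistance_dist F E x y).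

Lemma rf_cst_eq0 c : E (cst c) (cst c) = 0.
Proof. by apply/(rf_eq0 hE (rf_cst hE c)); exists c. Qed.

Lemma rf_parallelogram f g : F f -> F g ->
  E (f \+ g) (f \+ g) + E (f \- g) (f \- g) = 2 * E f f + 2 * E g g.
Proof.
move=> Ff Fg.
have -> : f \+ g = (fun x => 1 * f x + g x).
  by apply/funext => x /=; rewrite mul1r.
have -> : f \- g = (fun x => -1 * g x + f x).
  by apply/funext => x /=; rewrite mulN1r addrC.
have Fs := rf_lin hE 1 Ff Fg; have Fd := rf_lin hE (-1) Fg Ff.
rewrite !(rf_bilin hE)// !(rf_sym hE _ Fs)// !(rf_sym hE _ Fd)//.
by rewrite !(rf_bilin hE)// (rf_sym hE Fg Ff); ring.
Qed.

(** Parallelogram law for [f - g] and [g - h], whose sum is [f - h]; the energy of their difference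
    is non-negative and is dropped. *)
Lemma rf_subE_le f g h : F f -> F g -> F h ->
  E (f \- h) (f \- h) <=
    2 * E (f \- g) (f \- g) + 2 * E (g \- h) (g \- h).
Proof.
move=> Ff Fg Fh; have Fd1 := rf_sub hE Ff Fg; have Fd2 := rf_sub hE Fg Fh.
rewrite -(rf_parallelogram Fd1 Fd2).
have -> : (f \- g) \+ (g \- h) = f \- h.
  by apply/funext => x /=; ring.
by rewrite lerDl; apply: (rf_ge0 hE); apply: (rf_sub hE).
Qed.

Lemma rf_subE_sym f g : F f -> F g ->
  E (f \- g) (f \- g) = E (g \- f) (g \- f).
Proof.
move=> Ff Fg; have Fd := rf_sub hE Fg Ff.
(* [rf_bilin] speaks only of combinations [a * f + g], so a negation is written with the zero
   function as second summand. *)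
have -> : f \- g = (fun x => -1 * (g \- f) x + cst 0 x).
  by apply/funext => x /=; ring.
have F0 := rf_cst hE 0; have Fs := rf_lin hE (-1) Fd F0.
have E0 u : F u -> E (cst 0) u = 0.
  move=> Fu; have := rf_bilin hE 1 F0 F0 Fu.
  have -> : (fun x => 1 * cst 0 x + cst 0 x) = cst 0 :> (T -> R).
    by apply/funext => x /=; ring.
  by move=> h; lra.
rewrite (rf_bilin hE)// E0// (rf_sym hE _ Fs)// (rf_bilin hE)// E0//.
by ring.
Qed.

Lemma rf_pointwise_le f x y : F f ->
  f x ^+ 2 <= 2 * f y ^+ 2 + 2 * (mdist x y * E f f).
Proof.
move=> Ff; have := resistance_ineq hE hR x y Ff; rewrite real_normK ?num_real//.
by have := sqrrB_le (f x) (f y) 0; rewrite !subr0; lra.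
Qed.

Lemma E_at_subE_le x0 f g h : F f -> F g -> F h ->
  E_at E x0 (f \- h) (f \- h) <=
    2 * E_at E x0 (f \- g) (f \- g) + 2 * E_at E x0 (g \- h) (g \- h).
Proof.
move=> Ff Fg Fh; rewrite /E_at -!expr2 /=.
by have := rf_subE_le Ff Fg Fh; have := sqrrB_le (f x0) (g x0) (h x0); lra.
Qed.

Lemma form_cvg_cauchy (u : nat -> T -> R) f : (forall n, F (u n)) -> F f ->
  form_cvg E u f -> form_cauchy E u.
Proof.
move=> Fu Ff /cvgrPdist_lt uf e e0.
have e40 : 0 < e / 4 by rewrite divr_gt0.
have [N _ hN] := uf _ e40; exists N => m n mN nN.
have := hN _ mN; have := hN _ nN; rewrite /= !sub0r !normrN.
rewrite !ger0_norm ?(rf_ge0 hE (rf_sub hE _ _))//.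
have := rf_subE_le (Fu m) Ff (Fu n).
by rewrite (rf_subE_sym Ff (Fu n)); lra.
Qed.

(** Energy convergence does not see additive constants; convergence at [y] fixes the constant. *)
Lemma form_cvg_pointwise (u : nat -> T -> R) f x y :
  (forall n, F (u n)) -> F f -> form_cvg E u f ->
  u n y @[n --> \oo] --> f y -> u n x @[n --> \oo] --> f x.
Proof.
move=> Fu Ff uf uy; apply/subr_cvg0; apply: sqr_cvg0.
apply: (@squeeze_cvgr _ _ _ _ (cst 0) (fun n =>
      2 * ((u n y - f y) * (u n y - f y)) +
      2 * (mdist x y * E (u n \- f) (u n \- f)))).
- apply: nearW => n; rewrite sqr_ge0 -expr2.
  exact: (rf_pointwise_le x y (rf_sub hE (Fu n) Ff)).
- exact: cvg_cst.
- have uy0 : u n y - f y @[n --> \oo] --> 0 by apply/subr_cvg0.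
  rewrite [X in _ --> X](_ : _ = 2 * (0 * 0) + 2 * (mdist x y * 0)); last ring.
  apply: cvgD; apply: cvgMr; first exact: cvgM.
  exact: cvgMr.
Qed.

End resistance_forms.

(** * Continuous functions and the Borel measure *)

Section borel.
Context {R : realType} {T : pmetricType R}.

Lemma continuous_borel_measurable (f : T -> R) : continuous f ->
  measurable_fun setT (f : borel T -> R).
Proof.
move=> /continuousP cf; apply: (measurability _ (RGenOpens.measurableE R)).
move=> _ [_ [a [b ->] <-]]; rewrite setTI; apply: sub_sigma_algebra.
by apply: cf; exact: interval_open.
Qed.

(** The square of [f] is bounded on the compact support, which has finite measure, and vanishes off
    it. *)
Lemma Cc_Lfun2 (mu : {measure set (borel T) -> \bar R}) (f : T -> R) :
  (forall K : set T, compact K -> (mu K < +oo)%E) -> Cc f -> L2 mu f.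
Proof.
move=> muK [cf]; set K := closure _ => cK.
have mf := continuous_borel_measurable cf.
have mK : measurable (K : set (borel T)).
  rewrite -(setCK K); apply: measurableC; apply: sub_sigma_algebra.
  by apply: closed_openC; exact: closed_closure.
rewrite /L2/= inE; apply/andP; split; rewrite inE//=.
rewrite /finite_norm unlock poweR_lty//.
have /continuous_compact/(_ cK) : {within K, continuous (fun x => f x ^+ 2)}.
  by apply: continuous_subspaceT => x; exact: continuousM (cf x) (cf x).
move=> /compact_bounded[M [_ fM]].
have bdK : [bounded (f x : R^o) ^+ 2 | x in K].
  exists M; split; rewrite ?num_real // => B MB x Kx /=.
  by apply: (fM B MB); exists x.
have : mu.-integrable K (EFin \o (fun x => f x ^+ 2)).
  apply: measurable_bounded_integrable => //; first exact: muK.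
  by apply: measurable_funTS; exact: measurable_funX.
move=> /(integrable_mkcond _ mK)/integrableP[_]; apply: le_lt_trans.
rewrite le_eqVlt; apply/orP; left; apply/eqP; apply: eq_integral => x _.
rewrite patchE/= powR_mulrn// real_normK ?num_real//.
case: ifPn => [_|/negP xK] /=; first by rewrite ger0_norm// sqr_ge0.
suff -> : f x = 0 by rewrite expr0n; exact/esym/abse0.
apply/eqP/negP => /negP fx; apply: xK; rewrite inE.
exact: subset_closure.
Qed.

End borel.

(** * The two inclusions *)

Section extended.
Context {R : realType} {T : pmetricType R}.
Variables (F : set (T -> R)) (E : (T -> R) -> (T -> R) -> R).
Variable mu : {measure set (borel T) -> \bar R}.
Hypotheses (hE : resistance_form F E)
  (hR : forall x y : T, mdist x y = resistance_dist F E x y)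
  (hlc : locally_compact [set: T])
  (muK : forall K : set T, compact K -> (mu K < +oo)%E)
  (hsupp : full_support mu).

(** The real integral is [fine] of a non-negative extended one, and [fine +oo = 0]. *)
Lemma E1_int_ge0 (w : T -> R) : 0 <= \int[mu]_x (w x * w x).
Proof.
by apply: fine_ge0; apply: integral_ge0 => x _; rewrite lee_fin -expr2 sqr_ge0.
Qed.

Lemma E1_pointwise x0 e : 0 < e -> exists2 d, 0 < d &
  forall w, F w -> L2 mu w -> E1 E mu w w < d -> w x0 ^+ 2 < e.
Proof.
move=> e0; have [K] := @hlc x0 I.
rewrite /= /within/= => xK [cK _].
have x0K : nbhs x0 K by apply: filterS xK => y; exact.
have x0B : nbhs x0 (ball x0 (1 : R)) by exact: nbhsx_ballx.
(* Openness gives [0 < mu U], the compact [K] gives [mu U < +oo], and the unit ball bounds the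
   distance factor of the oscillation bound by 1. *)
set U : set (borel T) := interior (K `&` ball x0 1).
have Ux0 : U x0 by apply: filterI.
have oU : open (U : set T) by exact: open_interior.
have mU : measurable U by exact: sub_sigma_algebra.
have UK : U `<=` K by move=> y /interior_subset[].
have mK : measurable (K : set (borel T)).
  rewrite -(setCK K); apply: measurableC; apply: sub_sigma_algebra.
  by apply: closed_openC; apply: compact_closed => //; exact: metric_hausdorff.
have U0 : (0 < mu U)%E by apply: hsupp => //; exists x0.
have Ufin : mu U \is a fin_num.
  rewrite ge0_fin_numE ?measure_ge0//.
  by apply: le_lt_trans (muK cK); apply: le_measure => //; rewrite inE.
have m0 : 0 < fine (mu U) by rewrite fine_gt0// U0 -ge0_fin_numE ?measure_ge0.
have e4 : 0 < e / 4 by rewrite divr_gt0.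
(* If [e <= w x0 ^+ 2], energy below [e / 4] leaves [w ^+ 2 >= e / 4] on [U], so the integral is at
   least [e / 4 * mu U], against the second bound. *)
exists (Num.min (e / 4) (e / 4 * fine (mu U))).
  by rewrite lt_min e4 mulr_gt0.
move=> w Fw L2w; rewrite lt_min => /andP[w1 w2].
rewrite ltNge; apply/negP => wx0.
have Ew := rf_ge0 hE Fw.
have wU y : U y -> e / 4 <= w y ^+ 2.
  move=> /interior_subset[_]; rewrite ballEmdist/= => y1.
  have := rf_pointwise_le hE hR x0 y Fw.
  have : mdist x0 y * E w w <= E w w by rewrite ler_piMl// ltW.
  by have := E1_int_ge0 w; move: w1; rewrite /E1; lra.
have iw : mu.-integrable [set: borel T] (EFin \o (fun x => w x ^+ 2)).
  exact: Lfun2_integrable_sqr L2w.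
have le : ((e / 4)%:E * mu U <= \int[mu]_x (w x ^+ 2)%:E)%E.
  rewrite -integral_cst//.
  have mw := measurable_int mu iw.
  apply: (@le_trans _ _ (\int[mu]_(x in U) (w x ^+ 2)%:E)%E).
    apply: ge0_le_integral => //.
    - by move=> x _; rewrite lee_fin ltW.
    - exact: measurable_funTS mw.
  apply: ge0_subset_integral => //.
  by move=> x _; rewrite lee_fin sqr_ge0.
move: w2; rewrite /E1 ltNge => /negP; apply.
rewrite -[leLHS]add0r lerD//.
under eq_Rintegral do rewrite -expr2.
rewrite -[leLHS]/(fine (e / 4 * fine (mu U))%:E) /Rintegral fine_le//.
- exact: integrable_fin_num iw.
- by rewrite EFinM fineK.
Qed.

(** Approximation in two stages: [g] by some [u N] of the Dirichlet domain in [E_at], then [u N] by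
    an element of [Cc] in [E1], which [E1_pointwise] converts to [E_at]. *)
Lemma extended_dirichlet_F1 x0 : extended_dirichlet_cont F E mu `<=` F1 F E x0.
Proof.
move=> g [f De [gc fg]].
have [_ _ [u [Du uC uf]]] := De.
have Fu n : F (u n) by have [[]] := Du n.
have L2u n : L2 mu (u n) by have [[]] := Du n.
have [h Fh uh] := rf_complete hE Fu uC.
have [x1 [_ [f1 u1]]] : setT `&` [set x | f x = (g x)%:E /\
    (u n x)%:E @[n --> \oo] --> f x] !=set0.
  apply: full_support_ae; first exact: hsupp.
  - by apply: filterS2 fg uf => z; split.
  - by exists point.
  - exact: openT.
have {}u1 : u n x1 @[n --> \oo] --> g x1 by move: u1; rewrite f1 => /fine_cvg.
(* Completeness yields [h] only up to a constant; the shift makes it agree with [g] at [x1], a point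
   of convergence supplied by full support. *)
pose g' x := h x - h x1 + g x1.
have Fg' : F g'.
  have := rf_lin hE 1 Fh (rf_cst hE (g x1 - h x1)).
  by congr F; apply/funext => x; rewrite /g'/=; ring.
have Ehg' : E (h \- g') (h \- g') = 0.
  rewrite (_ : h \- g' = cst (h x1 - g x1)) ?(rf_cst_eq0 hE)//.
  by apply/funext => x; rewrite /g'/=; ring.
have ug' : form_cvg E u g'.
  apply: (@squeeze_cvgr _ _ _ _ (cst 0)
    (fun n => 2 * E (u n \- h) (u n \- h))).
  - apply: nearW => n; rewrite (rf_ge0 hE (rf_sub hE _ _))//=.
    by have := rf_subE_le hE (Fu n) Fh Fg'; rewrite Ehg' mulr0 addr0.
  - exact: cvg_cst.
  - by rewrite -[X in _ --> X](mulr0 2); exact: cvgMr.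
have g'x1 : g' x1 = g x1 by rewrite /g'; ring.
rewrite -g'x1 in u1.
have u_g' x : u n x @[n --> \oo] --> g' x.
  exact: (form_cvg_pointwise hE hR Fu Fg' ug' u1).
(* Both are continuous modifications of [f], hence equal. *)
have g'g : g' = g.
  have [k [_ kuniq]] := extended_dirichlet_modification hE hR hsupp De.
  rewrite -(kuniq g)// -(kuniq g')//; split; first exact: (rf_continuous hE hR Fg').
  apply: filterS2 fg uf => x _ ux; apply: (cvg_unique _ ux) => //.
  by apply: cvg_EFin; [exact: nearW|exact: u_g'].
rewrite -g'g; split => // e e0.
have uE : E_at E x0 (g' \- u n) (g' \- u n) @[n --> \oo] --> 0.
  have gu0 : g' x0 - u n x0 @[n --> \oo] --> 0.
    by rewrite -[X in _ --> X](subrr (g' x0)); apply: cvgB => //; exact: cvg_cst.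
  have -> : (fun n => E_at E x0 (g' \- u n) (g' \- u n)) = (fun n =>
      E (u n \- g') (u n \- g') + (g' x0 - u n x0) * (g' x0 - u n x0)).
    by apply/funext => n; rewrite /E_at (rf_subE_sym hE).
  rewrite [X in _ --> X](_ : _ = 0 + 0 * 0); last by rewrite mulr0 addr0.
  by apply: cvgD => //; exact: cvgM.
(* Error budget: [2 * (e / 4)] for the first stage and [2 * (e / 8 + e / 8)] for the energy and the
   value at [x0] in the second. *)
have e40 : 0 < e / 4 by rewrite divr_gt0.
have [N _ /(_ N (leqnn N))/=] := (cvgrPdist_lt _ _).1 uE _ e40.
rewrite sub0r normrN => /(le_lt_trans (ler_norm _)) EN.
have [d d0 hd] := E1_pointwise x0 (divr_gt0 e0 (ltr0n _ 8)).
have [_ /(_ (Num.min d (e / 8)))[|v Cv Ev]] := Du N.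
  by rewrite lt_min d0 divr_gt0.
have Fv : F v by case: Cv.
exists v => //.
have Fuv := rf_sub hE (Fu N) Fv.
have L2v : L2 mu v by apply: Cc_Lfun2 => //; case: Cv.
have L2uv : L2 mu (u N \- v).
  by rewrite /L2/= rpredB ?lee1n//= => _; exact: L2u.
move: Ev; rewrite lt_min => /andP[/(hd _ Fuv L2uv) Ev1 Ev2].
have Ev3 : E (u N \- v) (u N \- v) < e / 8.
  by apply: le_lt_trans Ev2; rewrite lerDl E1_int_ge0.
have := E_at_subE_le hE x0 Fg' (Fu N) Fv.
by move: EN Ev1 Ev3; rewrite /E_at -!expr2/=; lra.
Qed.

(** The approximants in [Cc] already lie in the Dirichlet domain, and the term at [x0] in [E_at]
    provides the point of convergence; pointwise convergence then holds everywhere. *)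
Lemma F1_extended_dirichlet x0 : F1 F E x0 `<=` extended_dirichlet_cont F E mu.
Proof.
move=> g [Fg gcl].
have gc := rf_continuous hE hR Fg.
have /choice[v vP] n : exists v, (F `&` Cc) v /\
    E_at E x0 (g \- v) (g \- v) < n.+1%:R^-1.
  by have [|v ? ?] := gcl n.+1%:R^-1; [|exists v].
have Fv n : F (v n) by have [[]] := vP n.
have Evg n : E (v n \- g) (v n \- g) < n.+1%:R^-1.
  rewrite (rf_subE_sym hE)//; apply: le_lt_trans (vP n).2.
  by rewrite lerDl -expr2 sqr_ge0.
have vg : form_cvg E v g.
  apply: (@squeeze_cvgr _ _ _ _ (cst 0) (fun n => n.+1%:R^-1)).
  - by apply: nearW => n; rewrite (rf_ge0 hE (rf_sub hE _ _))//= ltW// Evg.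
  - exact: cvg_cst.
  - exact: cvg_harmonic.
have vx0 : v n x0 @[n --> \oo] --> g x0.
  apply/subr_cvg0; apply: sqr_cvg0.
  apply: (@squeeze_cvgr _ _ _ _ (cst 0) (fun n => n.+1%:R^-1)).
  - apply: nearW => n; rewrite sqr_ge0/= ltW//; apply: le_lt_trans (vP n).2.
    rewrite /E_at -expr2 -sqrrN opprB lerDr.
    exact: (rf_ge0 hE (rf_sub hE _ _)).
  - exact: cvg_cst.
  - exact: cvg_harmonic.
exists (EFin \o g); last by split => //; exact: aeW.
split.
- by apply/measurable_EFinP; exact: continuous_borel_measurable.
- exact: aeW.
- exists v; split.
  + move=> n; split; first by split => //; apply: Cc_Lfun2 => //; case: (vP n) => -[].
    (* Each [v n] is its own approximant, at [E1]-distance 0. *)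
    move=> e e0; exists (v n); first by case: (vP n).
    rewrite /E1 (_ : v n \- v n = cst 0); last first.
      by apply/funext => x /=; rewrite subrr.
    rewrite (rf_cst_eq0 hE) add0r /=.
    under eq_Rintegral do rewrite mulr0.
    by rewrite Rintegral_cst ?mul0r.
  + exact: (form_cvg_cauchy hE) vg.
  + apply: aeW => x; apply: cvg_EFin; first exact: nearW.
    exact: (form_cvg_pointwise hE hR Fv Fg vg vx0).
Qed.

End extended.

Unset Implicit Arguments.
Set Strict Implicit.

Theorem theorem3p20 (R : realType) (T : pmetricType R)
    (F : set (T -> R)) (E : (T -> R) -> (T -> R) -> R)
    (mu : {measure set (borel T) -> \bar R}) (x0 : T)
    (hE : resistance_form F E)
    (hR : forall x y : T, mdist x y = resistance_dist F E x y)
    (hreg : regular_form F)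
    (hsep : separable T)
    (hlc : locally_compact [set: T])
    (hmu : radon_measure mu)
    (hsupp : full_support mu) :
  extended_dirichlet_cont F E mu = F1 F E x0.
Proof.
have muK := radon_compact hmu.
apply/seteqP; split.
- exact: extended_dirichlet_F1.
- exact: F1_extended_dirichlet.
Qed.
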